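(* Suppose that $\delta^\nu\in(\epsilon,\infty]$ with $\delta^\nu\to\delta\in(\epsilon,\infty]$, $\tau^\nu\in[0,\infty)$ with $\tau^\nu\to 0$, and $\boldsymbol{\xi}^\nu\to\bar{\boldsymbol{\xi}}$ (that is, $\boldsymbol{\xi}^\nu(\omega)\to\bar\xi$ for every $\omega\in\Omega$), and that the following hold: (a) The risk measures $\mathcal{R}_0,\mathcal{R}_1,\dots,\mathcal{R}_q$ are real-valued and continuous; $\mathcal{R}_1,\dots,\mathcal{R}_q$ are also monotone. (b) For any $k=0,1,\dots,q$, $\xi\in\Xi$, and $(x,y)\in C$, one has $\psi_k^\nu(\xi^\nu,x^\nu,y)\to\psi_k(\xi,x,y)$ whenever $\xi^\nu\in\Xi\to\xi$ and $(x^\nu,y)\in C\to(x,y)$. (c) $F+a\in\mathcal{F}$ for any $F\in\mathcal{F}$ and $a\in\mathbb{R}^n$; and $G+b\in\mathcal{G}$ for any $G\in\mathcal{G}$ and $b\in\mathbb{R}^m$. (d) There exists $h:\mathcal{F}\times\mathcal{G}\to[0,\infty)$ with the properties that $h(F,G)=h(F+a,G+b)$ for any $F\in\mathcal{F}$, $a\in\mathbb{R}^n$, $G\in\mathcal{G}$, and $b\in\mathbb{R}^m$; and $h^\nu(F^\nu,G^\nu)\to h(F,G)$ whenever $(F^\nu,G^\nu)\to(F,G)$ in $\mathcal{F}\times\mathcal{G}$. (e) There exists $(F,G)\in\mathcal{F}\times\mathcal{G}$ producing $G(\bar\xi)\in D_\epsilon(\delta)$ and a feasible point $(F(\bar\xi),\mathbb{H}(G(\bar\xi)))$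 for $(\mathrm{AP})(\bar\xi)$. For each $(F,G)\in\mathcal{F}\times\mathcal{G}$ with these properties there exist $x^\nu\to F(\bar\xi)$ and $\gamma^\nu\in(0,\infty)\to 0$ that also satisfy, for all $\nu\in\mathbb{N}$, $$\psi_k\big(\bar\xi,x^\nu,\mathbb{H}(G(\bar\xi))\big)<0,\ k=1,\dots,q,\qquad\text{and}\qquad \big(z,\mathbb{H}(G(\bar\xi))\big)\in C\ \ \forall z\in\mathbb{R}^n \text{ with } \|z-x^\nu\|_2\le\gamma^\nu .$$ (f) For each $\nu\in\mathbb{N}$, $(\hat F^\nu,\hat G^\nu)$ is a $\tau^\nu$-minimizer of $(\mathrm{TP})^\nu$. If there is a subsequence $N\subset\mathbb{N}$ such that $(\hat F^\nu,\hat G^\nu)\to(F^\star,G^\star)\in\mathcal{F}\times\mathcal{G}$ along $\nu\in N$, then: $\mathbb{H}(\hat G^\nu(\boldsymbol{\xi}^\nu(\omega)))=\mathbb{H}(G^\star(\bar\xi))$ for all $\omega\in\Omega$ when $\nu\in N$ is sufficiently large; $G^\star(\bar\xi)\in D_\epsilon(\delta)$; $$\big(F^\star(\bar\xi),\mathbb{H}(G^\star(\bar\xi))\big)\in\operatorname*{argmin}_{(x,y)\in C}\big\{\psi_0(\bar\xi,x,y)\ \big|\ \psi_k(\bar\xi,x,y)\le 0,\ k=1,\dots,q\big\};$$ and, along $\nu\in N$, $$\mathcal{R}_0\Big(\psi_0^\nu\big(\boldsymbol{\xi}^\nu,\hat F^\nu(\boldsymbol{\xi}^\nu),\mathbb{H}(\hat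 G^\nu(\boldsymbol{\xi}^\nu))\big)\Big)+h^\nu(\hat F^\nu,\hat G^\nu)\ \to\ \inf_{(x,y)\in C}\big\{\psi_0(\bar\xi,x,y)\ \big|\ \psi_k(\bar\xi,x,y)\le 0,\ k=1,\dots,q\big\}+h(F^\star,G^\star).$$ Under the additional assumption that $\mathcal{F}$ and $\mathcal{G}$ contain their respective zero mappings and $h(F,G)=0$ only when $F$ and $G$ are constant mappings, we also have that $F^\star$ and $G^\star$ are constant mappings and, consequently, $h(F^\star,G^\star)=0$.
   Context: Actual problem. $C\subset\mathbb{R}^n\times\{0,1\}^m$ is nonempty and closed, and $\psi_k:\mathbb{R}^r\times\mathbb{R}^n\times\mathbb{R}^m\to\mathbb{R}$, $k=0,1,\dots,q$, are continuous. For $\xi\in\mathbb{R}^r$, $(\mathrm{AP})(\xi)$ is the problem of minimizing $\psi_0(\xi,x,y)$ over $(x,y)\in C$ subject to $\psi_k(\xi,x,y)\le 0$, $k=1,\dots,q$. Heaviside mapping. $\mathbb{H}(v)=(w_1,\dots,w_s)$ for $v\in\mathbb{R}^s$, where $w_i=0$ if $v_i\le 0$ and $w_i=1$ otherwise. Probability space and risk measures. $(\Omega,2^\Omega,P)$ is a finite probability space with $P(\omega)>0$ for all $\omega\in\Omega$. Random variables are functions $\Omega\to\mathbb{R}$. A risk measure $\mathcal{R}$ assigns to each random variable $\boldsymbol{\eta}$ a number $\mathcal{R}(\boldsymbol{\eta})\in[-\infty,\infty]$, with $\mathcal{R}(\boldsymbol{\eta})=\eta$ whenever $\boldsymbol{\eta}$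 equals the constant $\eta$ with probability one. $\mathcal{R}$ is monotone if $\mathcal{R}(\boldsymbol{\eta})\le\mathcal{R}(\boldsymbol{\eta}')$ whenever $\boldsymbol{\eta}(\omega)\le\boldsymbol{\eta}'(\omega)$ for all $\omega\in\Omega$; it is continuous if $\boldsymbol{\eta}^\nu\to\boldsymbol{\eta}$ pointwise implies $\mathcal{R}(\boldsymbol{\eta}^\nu)\to\mathcal{R}(\boldsymbol{\eta})$. $\mathcal{R}_0,\dots,\mathcal{R}_q$ are risk measures. Training points. $\boldsymbol{\xi}^\nu:\Omega\to\mathbb{R}^r$, $\nu\in\mathbb{N}=\{1,2,\dots\}$, are random vectors; $\bar\xi\in\mathbb{R}^r$, and $\bar{\boldsymbol{\xi}}$ is the random vector with $\bar{\boldsymbol{\xi}}(\omega)=\bar\xi$ for all $\omega$. $\Xi\subset\mathbb{R}^r$ is a compact set containing $\bar\xi$ and all $\boldsymbol{\xi}^\nu(\omega)$, $\nu\in\mathbb{N}$, $\omega\in\Omega$. Decision rules. $\mathcal{F}$ is a set of continuous mappings $\Xi\to\mathbb{R}^n$ and $\mathcal{G}$ a set of continuous mappings $\Xi\to\mathbb{R}^m$. Convergence $(F^\nu,G^\nu)\to(F,G)$ in $\mathcal{F}\times\mathcal{G}$ means uniform convergence on $\Xi$. $F+a$ denotes $\xi\mapsto F(\xi)+a$. The number $\epsilon\in(0,\infty)$ is fixed; for $\delta\in(\epsilon,\infty]$, $D_\epsilon(\delta)=\big([-\delta,-\epsilon]\cup[\epsilon,\delta]\big)^m$ as a subset of $\mathbb{R}^m$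 (so for $\delta=\infty$ it is $((-\infty,-\epsilon]\cup[\epsilon,\infty))^m$). Training problem. For each $\nu\in\mathbb{N}$, $\psi_k^\nu:\mathbb{R}^r\times\mathbb{R}^n\times\mathbb{R}^m\to\mathbb{R}$, $k=0,\dots,q$, are continuous and $h^\nu:\mathcal{F}\times\mathcal{G}\to[0,\infty)$. $(\mathrm{TP})^\nu$ is the problem of minimizing over $F\in\mathcal{F}$, $G\in\mathcal{G}$ the quantity $$\mathcal{R}_0\Big(\psi_0^\nu\big(\boldsymbol{\xi}^\nu,F(\boldsymbol{\xi}^\nu),\mathbb{H}(G(\boldsymbol{\xi}^\nu))\big)\Big)+h^\nu(F,G)$$ subject to $\mathcal{R}_k\big(\psi_k^\nu(\boldsymbol{\xi}^\nu,F(\boldsymbol{\xi}^\nu),\mathbb{H}(G(\boldsymbol{\xi}^\nu)))\big)\le 0$ for $k=1,\dots,q$; $\big(F(\boldsymbol{\xi}^\nu(\omega)),\mathbb{H}(G(\boldsymbol{\xi}^\nu(\omega)))\big)\in C$ for all $\omega\in\Omega$; and $G(\boldsymbol{\xi}^\nu(\omega))\in D_\epsilon(\delta^\nu)$ for all $\omega\in\Omega$. Here $\psi_k^\nu(\boldsymbol{\xi}^\nu,F(\boldsymbol{\xi}^\nu),\mathbb{H}(G(\boldsymbol{\xi}^\nu)))$ is the random variable $\omega\mapsto\psi_k^\nu(\boldsymbol{\xi}^\nu(\omega),F(\boldsymbol{\xi}^\nu(\omega)),\mathbb{H}(G(\boldsymbol{\xi}^\nu(\omega))))$. A $\tau^\nu$-minimizer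 of $(\mathrm{TP})^\nu$ is a feasible $(F^\nu,G^\nu)\in\mathcal{F}\times\mathcal{G}$ whose objective value is at most $\mathfrak{m}^\nu+\tau^\nu<\infty$, where $\mathfrak{m}^\nu$ is the minimum value (infimum of the objective over the feasible set) of $(\mathrm{TP})^\nu$.
   Formalization: In the last sentence, ''h(F,G)=0 only when F and G are constant mappings'' is taken as ''if and only if'': with ''only when'' alone, h identically 1 satisfies the assumption vacuously, while F* may be nonconstant and h(F*,G* )=1. *)

(* Defs.v *)
From HB Require Import structures.
From mathcomp Require Import all_boot all_order all_algebra.
From mathcomp Require Import all_classical all_reals all_analysis.

Set Implicit Arguments.
Unset Strict Implicit.
Unset Printing Implicit Defensive.

Import Order.TTheory GRing.Theory Num.Theory.
Import numFieldNormedType.Exports.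

Local Open Scope classical_set_scope.
Local Open Scope ring_scope.

(* Vectors of R^n are row vectors 'rV[R]_n with the product topology.  The
   norm provided by the library on row vectors is the sup norm, hence: *)
Definition norm2 {R : realType} {n : nat} (x : 'rV[R]_n) : R :=
  Num.sqrt (\sum_(j < n) x ord0 j ^+ 2).

Definition heaviside {R : realType} {s : nat} (v : 'rV[R]_s) : 'rV[R]_s :=
  \row_j (if v ord0 j <= 0 then 0 else 1).

(* delta ranges over the extended reals; delta = +oo removes the outer
   bounds. *)
Definition Deps {R : realType} {m : nat} (eps : R) (delta : \bar R) :
    set 'rV[R]_m :=
  [set y | forall j : 'I_m,
    (- delta <= (y ord0 j)%:E /\ (y ord0 j)%:E <= (- eps)%:E)%E \/
    (eps%:E <= (y ord0 j)%:E /\ (y ord0 j)%:E <= delta)%E].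

(* Every subset is an event, so random variables are arbitrary functions
   Omega -> R. *)
Definition finite_probability_space {R : realType} {d : measure_display}
    {Omega : measurableType d} (P : probability Omega R) : Prop :=
  [/\ finite_set [set: Omega],
      (forall A : set Omega, measurable A) &
      (forall w : Omega, (0 < P [set w])%E)].

Definition risk_measure {R : realType} {d : measure_display}
    {Omega : measurableType d} (P : probability Omega R)
    (rho : (Omega -> R) -> \bar R) : Prop :=
  forall (eta : Omega -> R) (c : R),
    P [set w | eta w = c] = 1%E -> rho eta = c%:E.

Definition risk_real_valued {R : realType} {Omega : Type}
    (rho : (Omega -> R) -> \bar R) : Prop :=
  forall eta : Omega -> R, rho eta \is a fin_num.

Definition risk_monotone {R : realType} {Omega : Type}
    (rho : (Omega -> R) -> \bar R) : Prop :=
  forall eta eta' : Omega -> R,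
    (forall w, eta w <= eta' w) -> (rho eta <= rho eta')%E.

Definition risk_continuous {R : realType} {Omega : Type}
    (rho : (Omega -> R) -> \bar R) : Prop :=
  forall (eta_ : nat -> Omega -> R) (eta : Omega -> R),
    (forall w, eta_ nu w @[nu --> \oo] --> eta w) ->
    rho (eta_ nu) @[nu --> \oo] --> rho eta.

Definition argmin {R : realType} {T : Type} (A : set T) (f : T -> R) : set T :=
  [set z | A z /\ forall z', A z' -> f z <= f z'].

Definition minimum_value {R : realType} {T : Type} (A : set T)
    (f : T -> \bar R) : \bar R :=
  ereal_inf [set f z | z in A].

Definition near_minimizer {R : realType} {T : Type} (A : set T)
    (f : T -> \bar R) (tau : R) (z : T) : Prop :=
  [/\ A z, (f z <= minimum_value A f + tau%:E)%E &
      (minimum_value A f + tau%:E < +oo)%E].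

(* Index 0 of a family over 'I_q.+1 is the objective; the positive indices are
   the q constraints. *)
Definition AP_feasible {R : realType} {r n m q : nat}
    (C : set ('rV[R]_n * 'rV[R]_m))
    (psi : 'I_q.+1 -> 'rV[R]_r * 'rV[R]_n * 'rV[R]_m -> R)
    (xi : 'rV[R]_r) : set ('rV[R]_n * 'rV[R]_m) :=
  [set z | C z /\ forall k : 'I_q.+1, (0 < k)%N -> psi k (xi, z.1, z.2) <= 0].

(* A decision rule is a function on the subtype of points of Xi (coerced to a
   type, with the topology induced from R^r), so only its values on Xi
   matter. *)
Definition loss {R : realType} {r n m : nat} {Xi : set 'rV[R]_r}
    {Omega : Type} (psi : 'rV[R]_r * 'rV[R]_n * 'rV[R]_m -> R)
    (xi : Omega -> Xi) (F : Xi -> 'rV[R]_n) (G : Xi -> 'rV[R]_m) : Omega -> R :=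
  fun w => psi (\val (xi w), F (xi w), heaviside (G (xi w))).

Definition TP_objective {R : realType} {r n m q : nat} {Xi : set 'rV[R]_r}
    {Omega : Type} (Rk : 'I_q.+1 -> (Omega -> R) -> \bar R)
    (psi : 'I_q.+1 -> 'rV[R]_r * 'rV[R]_n * 'rV[R]_m -> R)
    (h : (Xi -> 'rV[R]_n) -> (Xi -> 'rV[R]_m) -> R)
    (xi : Omega -> Xi) (FG : (Xi -> 'rV[R]_n) * (Xi -> 'rV[R]_m)) : \bar R :=
  (Rk ord0 (loss (psi ord0) xi FG.1 FG.2) + (h FG.1 FG.2)%:E)%E.

Definition TP_feasible {R : realType} {r n m q : nat} {Xi : set 'rV[R]_r}
    {Omega : Type} (Rk : 'I_q.+1 -> (Omega -> R) -> \bar R)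
    (C : set ('rV[R]_n * 'rV[R]_m))
    (psi : 'I_q.+1 -> 'rV[R]_r * 'rV[R]_n * 'rV[R]_m -> R)
    (FF : set (Xi -> 'rV[R]_n)) (GG : set (Xi -> 'rV[R]_m))
    (eps : R) (delta : \bar R) (xi : Omega -> Xi) :
    set ((Xi -> 'rV[R]_n) * (Xi -> 'rV[R]_m)) :=
  [set FG | [/\ FF FG.1, GG FG.2,
    (forall k : 'I_q.+1, (0 < k)%N ->
      (Rk k (loss (psi k) xi FG.1 FG.2) <= 0)%E),
    (forall w, C (FG.1 (xi w), heaviside (FG.2 (xi w)))) &
    (forall w, Deps eps delta (FG.2 (xi w)))]].

Definition constant_map {S T : Type} (f : S -> T) : Prop :=
  exists c, forall s, f s = c.

(* The equivalence cannot be weakened to "h F G = 0 only if F and G are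
   constant": h identically 1 would satisfy that vacuously, and a nonzero value
   of h at constant maps would leave the minimizing rules unconstrained. *)
Definition vanishes_exactly_at_constants {R : realType} {X Y Z : Type}
    (FF : set (X -> Y)) (GG : set (X -> Z)) (h : (X -> Y) -> (X -> Z) -> R) :
    Prop :=
  forall F G, FF F -> GG G -> (h F G = 0 <-> constant_map F /\ constant_map G).

(* Main.v *)
Require Import Defs.
From HB Require Import structures.
From mathcomp Require Import all_boot all_order all_algebra.
From mathcomp Require Import all_classical all_reals all_analysis.

(** The computed rules converge to a feasible point of the actual problem:
    since each component of [Ghat] keeps distance [eps] from 0, its sign pattern
    is eventually that of [Gstar xibar], and continuous convergence of the losses
    then passes through the risk measures.

    For optimality, shift [Fstar] and [Gstar] by constants so that they produce
    an arbitrary feasible [(x, y)] at [xibar], with the shifted [Gstar] strictly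
    inside [Deps]; then move [F] further to a Slater point [x_ mu].  That pair is
    eventually feasible for the training problem, so its objective bounds the one
    of the near-minimizers.  Shifts leave [h] unchanged, so [h] cancels in the
    limit, and [mu] to infinity gives optimality.  The same comparison
    with constant rules producing the limit point shows [h Fstar Gstar <= 0]. *)

Set Implicit Arguments.
Unset Strict Implicit.
Unset Printing Implicit Defensive.

Import Order.TTheory GRing.Theory Num.Theory.
Import numFieldNormedType.Exports.

Local Open Scope classical_set_scope.
Local Open Scope ring_scope.

(** * Convergence along a subsequence and on the domain of the rules *)

Lemma within_infinite_proper (N : set nat) :
  infinite_set N -> ProperFilter (within N \oo).
Proof.
move=> Ninf; apply: Build_ProperFilter_ex => A.
case=> K _ NK; apply: contrapT => A0; apply: Ninf.
apply: (@sub_finite_set _ _ `I_K) => // k Nk /=.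
rewrite ltnNge; apply/negP => Kk; apply: A0; exists k; exact: (NK k).
Qed.

(* Full-sequence hypotheses apply to the subsequence [N] after freezing the terms
   outside [N] at the limit. *)
Lemma cvg_patch_within {T : topologicalType} (N : set nat) (u : nat -> T)
    (l : T) :
  u nu @[nu --> within N \oo] --> l ->
  patch (fun=> l) N u nu @[nu --> \oo] --> l.
Proof.
move=> ul A Al.
have : \forall nu \near \oo, N nu -> A (u nu) by exact: (ul A Al).
apply: filterS => nu /= NA.
rewrite /patch; case: ifPn => [/set_mem/NA//|_].
exact: nbhs_singleton.
Qed.

(** Way back from a patched full sequence to the original one along [N]. *)
Lemma cvg_within_eq {T : topologicalType} (N : set nat) (u v : nat -> T)
    (l : T) :
  {in N, u =1 v} -> u nu @[nu --> \oo] --> l ->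
  v nu @[nu --> within N \oo] --> l.
Proof.
move=> uv ul; have : u nu @[nu --> within N \oo] --> l.
  exact: cvg_within_filter.
apply: cvg_trans; apply: near_eq_cvg; near=> nu.
by rewrite uv //; apply: mem_set; near: nu; exact: near_withinT.
Unshelve. all: by end_near. Qed.

Lemma cvg_set_val {I : Type} {X : topologicalType} {A : set X}
    (D : set_system I) {FD : Filter D} (s : I -> A) (a : A) :
  \val (s i) @[i --> D] --> \val a -> s i @[i --> D] --> a.
Proof.
move=> sa U [_ [[W oW <-] Wa]] WU.
have Wn : nbhs (\val a) W by exact: open_nbhs_nbhs.
have : \forall i \near D, W (\val (s i)) by exact: (sa W Wn).
by apply: filterS => i; exact: WU.
Qed.

Lemma cvg_nbhs_pair {I : Type} {U V : topologicalType} (D : set_system I)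
    {FD : Filter D} (u : I -> U) (v : I -> V) (a : U) (b : V) :
  u i @[i --> D] --> a -> v i @[i --> D] --> b ->
  (u i, v i) @[i --> D] --> (a, b).
Proof. exact: cvg_pair. Qed.

(** Triangle inequality through [F (s i)]: continuity of [F] brings it close to [F x], and
    uniformity brings [F_ i (s i)] close to it although the evaluation point moves with [i]. *)
Lemma uniform_cvg_diag {I : Type} {X : topologicalType} {V : uniformType}
    (D : set_system I) {FD : Filter D} (F_ : I -> X -> V) (F : X -> V)
    (s : I -> X) (x : X) :
  continuous F -> {uniform, F_ @ D --> F} -> s i @[i --> D] --> x ->
  F_ i (s i) @[i --> D] --> F x.
Proof.
move=> cF FF sx; apply/cvg_entourageP => E entE; rewrite near_map; near=> i.
apply: (@entourage_split _ (F (s i))) => //.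
  near: i; have := cvg_comp _ _ sx (cF x) => /cvg_entourageP; apply.
  exact: entourage_split_ent.
near: i; have : \forall i \near D, forall y, split_ent E (F y, F_ i y).
  apply: (FF [set g | forall y, split_ent E (F y, g y)]).
  apply/uniform_nbhs; exists (split_ent E); split.
    exact: entourage_split_ent.
  by move=> g /= gE y; exact: gE.
by apply: filterS => i.
Unshelve. all: by end_near. Qed.

(** Finiteness of [Omega] enters here: eventual properties of each scenario hold eventually for all
    scenarios at once. *)
Lemma filter_forall_finite {I : eqType} {T : Type} (D : set_system T)
    {FD : Filter D} (Q : I -> T -> Prop) : finite_set [set: I] ->
  (forall i, \forall x \near D, Q i x) -> \forall x \near D, forall i, Q i x.
Proof.
move=> /finite_seqP[s sI] DQ.
suff: \forall x \near D, forall i, i \in s -> Q i x.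
  apply: filterS => x Qx i; apply: Qx.
  by have : [set: I] i by []; rewrite sI.
elim: s {sI} => [|i s IHs]; first by near=> x.
near=> x => j; rewrite inE => /predU1P[->|]; first by near: x.
by move: j; near: x.
Unshelve. all: by end_near. Qed.

(** * Norms, sign patterns and the set [Deps] *)

Lemma norm2_continuous {R : realType} (n : nat) :
  continuous (@norm2 R n).
Proof.
move=> x; rewrite /norm2; apply: continuous_comp; last exact: sqrt_continuous.
apply: continuous_big => [|j _ y]; first exact: add_continuous.
apply: (@continuous_comp _ _ _ (fun z : 'rV[R]_n => z ord0 j)
  (fun t => t ^+ 2)).
  exact: coord_continuous.
exact: exprn_continuous.
Qed.

Lemma norm2_0 {R : realType} (n : nat) : norm2 (0 : 'rV[R]_n) = 0.
Proof. by rewrite /norm2 big1 ?sqrtr0// => j _; rewrite mxE expr0n. Qed.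

Lemma cvg_coord {R : realType} {T : Type} (n : nat) (D : set_system T)
    {FD : Filter D} (y_ : T -> 'rV[R]_n) (y : 'rV[R]_n) (j : 'I_n) :
  y_ t @[t --> D] --> y -> y_ t ord0 j @[t --> D] --> y ord0 j.
Proof.
move=> ycvg; apply: (@cvg_comp _ _ _ y_ (fun z : 'rV[R]_n => z ord0 j)).
  exact: ycvg.
exact: coord_continuous.
Qed.

Lemma cvg_EFin_fun {R : realType} {I : Type} (D : set_system I)
    {FD : Filter D} (f : I -> R) (a : R) :
  f i @[i --> D] --> a -> (f i)%:E @[i --> D] --> a%:E.
Proof.
by move=> fa; apply: cvg_EFin => //; near=> i.
Unshelve. all: by end_near. Qed.

(** The intermediate value is real even for [y = +oo], which spares a separate treatment of an
    infinite [delta]. *)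
Lemma lt_EFin_between {R : realType} (x : R) (y : \bar R) :
  (x%:E < y)%E -> exists2 c, x < c & (c%:E < y)%E.
Proof.
case: y => [y| |] //; rewrite ?lte_fin => xy; last first.
  by exists (x + 1); rewrite ?ltrDl// ltry.
by exists ((x + y) / 2); rewrite ?lte_fin ?midf_lt.
Qed.

(** A perturbation of each coordinate by less than its absolute value preserves its sign. *)
Lemma heaviside_near {R : realType} (s : nat) (v : 'rV[R]_s) :
  (forall j, v ord0 j != 0) -> \forall u \near v, heaviside u = heaviside v.
Proof.
move=> v0.
have : \forall u \near v, forall j : 'I_s,
    `|(u : 'rV[R]_s) ord0 j - v ord0 j| < `|v ord0 j|.
  apply: (@filter_forall _ 'I_s _ (nbhs v)) => j.
  have /cvgrPdist_lt/(_ `|v ord0 j|) := @coord_continuous R _ _ ord0 j v.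
  by rewrite normr_gt0 => /(_ (v0 j)); apply: filterS => u; rewrite distrC.
apply: filterS => u uv; apply/rowP => j; rewrite !mxE.
have := uv j; have := v0 j.
have [v_gt0|v_lt0|] := ltgtP 0 (v ord0 j); last by [].
  rewrite (gtr0_norm v_gt0) ltr_distl => _ /andP[+ _].
  by rewrite subrr => /lt_geF ->.
rewrite (ltr0_norm v_lt0) ltr_distl => _ /andP[_].
by rewrite subrr => /ltW ->.
Qed.

(** Absolute values merge the two intervals, so limits need no case split on the sign. *)
Lemma DepsP {R : realType} (m : nat) (eps : R) (delta : \bar R)
    (y : 'rV[R]_m) : 0 < eps ->
  Deps eps delta y <->
  forall j, eps <= `|y ord0 j| /\ (`|y ord0 j|%:E <= delta)%E.
Proof.
move=> eps0; split=> yD j.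
  have [[dy ye]|[ey yd]] := yD j.
    move: ye; rewrite lee_fin => ye.
    have y0 : y ord0 j <= 0 by rewrite (le_trans ye)// oppr_le0 ltW.
    rewrite ler0_norm //; split; first by rewrite lerNr.
    by rewrite EFinN leeNl.
  move: ey; rewrite lee_fin => ey; rewrite ger0_norm//.
  exact: le_trans (ltW eps0) ey.
have [] := yD j; have [y0|y0] := leP 0 (y ord0 j).
  by rewrite ger0_norm// => *; right; rewrite lee_fin.
rewrite ltr0_norm// => *; left; split; first by rewrite leeNl.
by rewrite lee_fin lerNr.
Qed.

(** Non-strict inequalities survive limits, even with a moving outer bound. *)
Lemma Deps_cvg {R : realType} (m : nat) (eps : R) {T : topologicalType}
    (D : set_system T) {PD : ProperFilter D} (delta_ : T -> \bar R) (delta : \bar R)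
    (y_ : T -> 'rV[R]_m) (y : 'rV[R]_m) : 0 < eps ->
  (\forall nu \near D, Deps eps (delta_ nu) (y_ nu)) ->
  delta_ nu @[nu --> D] --> delta -> y_ nu @[nu --> D] --> y ->
  Deps eps delta y.
Proof.
move=> eps0 yD dcvg ycvg; apply/(DepsP _ _ eps0) => j.
have yj : `|y_ nu ord0 j| @[nu --> D] --> `|y ord0 j|.
  by apply: cvg_norm; exact: cvg_coord.
split.
  apply: cvgr_to_ge yj _.
  by apply: filterS yD => nu /(DepsP _ _ eps0)/(_ j)[].
apply: (@lee_cvg_to _ D _ _ (fun nu => `|y_ nu ord0 j|%:E) delta_ _ _ _ dcvg).
  exact: cvg_EFin_fun.
by apply: filterS yD => nu /(DepsP _ _ eps0)/(_ j)[].
Unshelve. all: by end_near. Qed.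

(** Strictness leaves room for a real [c] between [|y j|] and [delta]; eventually it also separates
    [|y_ nu j|] from the moving bound [delta_ nu]. *)
Lemma Deps_near {R : realType} (m : nat) (eps : R) {T : Type}
    (D : set_system T) {FD : Filter D} (delta_ : T -> \bar R) (delta : \bar R)
    (y_ : T -> 'rV[R]_m) (y : 'rV[R]_m) : 0 < eps ->
  (forall j, eps < `|y ord0 j| /\ (`|y ord0 j|%:E < delta)%E) ->
  delta_ nu @[nu --> D] --> delta -> y_ nu @[nu --> D] --> y ->
  \forall nu \near D, Deps eps (delta_ nu) (y_ nu).
Proof.
move=> eps0 yD dcvg ycvg.
have : \forall nu \near D, forall j, eps <= `|y_ nu ord0 j| /\
    (`|y_ nu ord0 j|%:E <= delta_ nu)%E.
  apply: (@filter_forall _ 'I_m _ D) => j; have [ey yd] := yD j.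
  have yj : `|y_ nu ord0 j| @[nu --> D] --> `|y ord0 j|.
    by apply: cvg_norm; exact: cvg_coord.
  have [c yc cd] : exists2 c : R, `|y ord0 j| < c & (c%:E < delta)%E.
    exact: lt_EFin_between.
  near=> nu; split; near: nu.
    exact: cvgr_ge yj _ ey.
  near=> nu; apply: (@le_trans _ _ c%:E).
    by rewrite lee_fin; near: nu; exact: cvgr_le yj _ yc.
  apply: ltW; near: nu; apply: (dcvg [set u | (c%:E < u)%E]).
  exact: open_ereal_gt'.
by apply: filterS => nu ?; apply/(DepsP _ _ eps0).
Unshelve. all: by end_near. Qed.

(* The comparison rules need the inequalities of [Deps] strictly at [xibar]. *)
Lemma heaviside_interior {R : realType} (m : nat) (eps : R) (delta : \bar R)
    (y : 'rV[R]_m) : 0 < eps -> (eps%:E < delta)%E ->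
  (forall j, y ord0 j = 0 \/ y ord0 j = 1) ->
  exists2 g : 'rV[R]_m, heaviside g = y &
    forall j, eps < `|g ord0 j| /\ (`|g ord0 j|%:E < delta)%E.
Proof.
move=> eps0 /lt_EFin_between[c ec cd] ybin.
have c0 : 0 < c by exact: lt_trans ec.
exists (\row_j (if y ord0 j == 0 then - c else c)).
  apply/rowP => j; rewrite !mxE; case: (ybin j) => ->.
    by rewrite eqxx oppr_le0 ltW.
  by rewrite oner_eq0 leNgt c0.
by move=> j; rewrite mxE; case: ifP => _; rewrite ?normrN gtr0_norm.
Qed.

(** * Risk of losses that converge to a constant *)

Lemma risk_cvg_cst {R : realType} {d : measure_display}
    {Omega : measurableType d} (P : probability Omega R)
    (rho : (Omega -> R) -> \bar R) (N : set nat)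
    (eta_ : nat -> Omega -> R) (c : R) :
  risk_measure P rho -> risk_continuous rho ->
  (forall w, eta_ nu w @[nu --> within N \oo] --> c) ->
  rho (eta_ nu) @[nu --> within N \oo] --> c%:E.
Proof.
move=> rhoP rho_cont etac.
have <- : rho (fun=> c) = c%:E.
  apply: rhoP; rewrite -[RHS](@probability_setT _ _ _ P); congr (P _).
  exact/seteqP.
apply: (@cvg_within_eq _ _ (fun nu => rho (patch (fun=> fun=> c) N eta_ nu))).
  by move=> nu nuN; rewrite patchT.
apply: rho_cont => w.
(* Patching the random variables and patching their values at [w] give the same sequence. *)
have := cvg_patch_within (etac w); apply: cvg_trans; apply: near_eq_cvg.
by near=> nu; rewrite /patch; case: ifP.
Unshelve. all: by end_near. Qed.

(** Links the product topology, in which rules converge, to the Euclidean balls of the Slater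
    condition. *)
Lemma near_norm2_le {R : realType} {T : Type} (n : nat) (D : set_system T)
    {FD : Filter D} (x_ : T -> 'rV[R]_n) (x : 'rV[R]_n) (gamma : R) :
  0 < gamma -> x_ t @[t --> D] --> x ->
  \forall t \near D, norm2 (x_ t - x) <= gamma.
Proof.
move=> gamma0 xcvg.
apply: (@cvgr_le _ _ _ _ (fun t => norm2 (x_ t - x)) 0) => //.
rewrite -(@norm2_0 R n).
apply: (@cvg_comp _ _ _ (fun t => x_ t - x)); last exact: norm2_continuous.
by rewrite -(subrr x); apply: cvgB => //; exact: cvg_cst.
Qed.

Lemma cvg_within_subset {T : topologicalType} (M N : set nat) (u : nat -> T)
    (l : T) : M `<=` N ->
  u nu @[nu --> within N \oo] --> l -> u nu @[nu --> within M \oo] --> l.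
Proof.
move=> MN ul A Al.
have : \forall nu \near \oo, N nu -> A (u nu) by exact: (ul A Al).
by apply: filterS => nu NA /MN.
Qed.

(** Serves the computed and the comparison rules alike: as all training points collapse to [xibar],
    the losses of all scenarios tend to one constant, which is its own risk. *)
Lemma risk_loss_cvg {R : realType} {r n m : nat}
    (C : set ('rV[R]_n * 'rV[R]_m))
    (psi : 'rV[R]_r * 'rV[R]_n * 'rV[R]_m -> R)
    (psi_ : nat -> 'rV[R]_r * 'rV[R]_n * 'rV[R]_m -> R)
    {d : measure_display} {Omega : measurableType d} (P : probability Omega R)
    (rho : (Omega -> R) -> \bar R) {Xi : set 'rV[R]_r} (xibar : Xi)
    (xi_ : nat -> Omega -> Xi) (N : set nat)
    (F_ : nat -> Xi -> 'rV[R]_n) (G_ : nat -> Xi -> 'rV[R]_m)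
    (x : 'rV[R]_n) (y : 'rV[R]_m) :
  risk_measure P rho -> risk_continuous rho ->
  (forall (s_ : nat -> Xi) (x_ : nat -> 'rV[R]_n),
     \val (s_ nu) @[nu --> \oo] --> \val xibar ->
     (forall nu, C (x_ nu, y)) -> x_ nu @[nu --> \oo] --> x ->
     psi_ nu (\val (s_ nu), x_ nu, y) @[nu --> \oo] --> psi (\val xibar, x, y)) ->
  (forall w, \val (xi_ nu w) @[nu --> \oo] --> \val xibar) ->
  C (x, y) ->
  (forall w, F_ nu (xi_ nu w) @[nu --> within N \oo] --> x) ->
  (\forall nu \near within N \oo, forall w, heaviside (G_ nu (xi_ nu w)) = y) ->
  (\forall nu \near within N \oo, forall w, C (F_ nu (xi_ nu w), y)) ->
  rho (loss (psi_ nu) (xi_ nu) (F_ nu) (G_ nu)) @[nu --> within N \oo] -->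
    (psi (\val xibar, x, y))%:E.
Proof.
move=> rhoP rho_cont psi_cvg xi_cvg Cxy Fx Gy CF.
apply: (risk_cvg_cst rhoP rho_cont) => w.
(* [psi_cvg] demands membership in [C] at every index, whereas [CF] gives it only eventually; the
   other terms are replaced by [x], for which [C (x, y)] holds. *)
pose M := N `&` [set nu | C (F_ nu (xi_ nu w), y)].
pose x_ := patch (fun=> x) M (fun nu => F_ nu (xi_ nu w)).
have x_cvg : x_ nu @[nu --> \oo] --> x.
  by apply: cvg_patch_within; apply: cvg_within_subset (Fx w); exact: subIsetl.
have Cx nu : C (x_ nu, y).
  by rewrite /x_ /patch; case: ifPn => // /set_mem[].
have := psi_cvg (fun nu => xi_ nu w) x_ (xi_cvg w) Cx x_cvg.
move=> /(@cvg_within_filter _ _ _ _ _ _ N); apply: cvg_trans; apply: near_eq_cvg.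
near=> nu; rewrite /loss /x_ /patch.
have -> : heaviside (G_ nu (xi_ nu w)) = y.
  by near: nu; apply: filterS Gy => nu /(_ w).
rewrite mem_set//; split; first by near: nu; exact: near_withinT.
by rewrite /=; near: nu; apply: filterS CF => nu /(_ w).
Unshelve. all: by end_near. Qed.

Theorem theorem3p1 (R : realType) (r n m q : nat)
  (* actual problem *)
  (C : set ('rV[R]_n * 'rV[R]_m))
  (C_binary : forall z, C z -> forall j, z.2 ord0 j = 0 \/ z.2 ord0 j = 1)
  (C_nonempty : C !=set0) (C_closed : closed C)
  (psi : 'I_q.+1 -> 'rV[R]_r * 'rV[R]_n * 'rV[R]_m -> R)
  (psi_cont : forall k, continuous (psi k))
  (* finite probability space and risk measures *)
  (d : measure_display) (Omega : measurableType d) (P : probability Omega R)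
  (P_finite : finite_probability_space P)
  (Rk : 'I_q.+1 -> (Omega -> R) -> \bar R)
  (Rk_risk : forall k, risk_measure P (Rk k))
  (* training points *)
  (Xi : set 'rV[R]_r) (Xi_compact : compact Xi)
  (xibar : Xi) (xi_ : nat -> Omega -> Xi)
  (* decision rules *)
  (FF : set (Xi -> 'rV[R]_n)) (GG : set (Xi -> 'rV[R]_m))
  (FF_cont : forall F, FF F -> continuous F)
  (GG_cont : forall G, GG G -> continuous G)
  (eps : R) (eps_gt0 : 0 < eps)
  (* training problems *)
  (psi_ : nat -> 'I_q.+1 -> 'rV[R]_r * 'rV[R]_n * 'rV[R]_m -> R)
  (psi__cont : forall nu k, continuous (psi_ nu k))
  (h_ : nat -> (Xi -> 'rV[R]_n) -> (Xi -> 'rV[R]_m) -> R)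
  (h__ge0 : forall nu F G, FF F -> GG G -> 0 <= h_ nu F G)
  (* parameters *)
  (delta_ : nat -> \bar R) (delta : \bar R)
  (delta__gt : forall nu, (eps%:E < delta_ nu)%E)
  (delta_gt : (eps%:E < delta)%E)
  (delta_cvg : delta_ nu @[nu --> \oo] --> delta)
  (tau_ : nat -> R) (tau__ge0 : forall nu, 0 <= tau_ nu)
  (tau_cvg : tau_ nu @[nu --> \oo] --> (0 : R))
  (xi_cvg : forall w, \val (xi_ nu w) @[nu --> \oo] --> \val xibar)
  (* (a) *)
  (Rk_real : forall k, risk_real_valued (Rk k))
  (Rk_cont : forall k, risk_continuous (Rk k))
  (Rk_mono : forall k : 'I_q.+1, (0 < k)%N -> risk_monotone (Rk k))
  (* (b) *)
  (psi_cvg : forall (k : 'I_q.+1) (xi : Xi) (x : 'rV[R]_n) (y : 'rV[R]_m),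
    C (x, y) ->
    forall (s_ : nat -> Xi) (x_ : nat -> 'rV[R]_n),
      \val (s_ nu) @[nu --> \oo] --> \val xi ->
      (forall nu, C (x_ nu, y)) ->
      x_ nu @[nu --> \oo] --> x ->
      psi_ nu k (\val (s_ nu), x_ nu, y) @[nu --> \oo]
        --> psi k (\val xi, x, y))
  (* (c) *)
  (FF_shift : forall F (a : 'rV[R]_n), FF F -> FF (fun s => F s + a))
  (GG_shift : forall G (b : 'rV[R]_m), GG G -> GG (fun s => G s + b))
  (* (d) *)
  (h : (Xi -> 'rV[R]_n) -> (Xi -> 'rV[R]_m) -> R)
  (h_ge0 : forall F G, FF F -> GG G -> 0 <= h F G)
  (h_shift : forall F G (a : 'rV[R]_n) (b : 'rV[R]_m), FF F -> GG G ->
    h F G = h (fun s => F s + a) (fun s => G s + b))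
  (h_cvg : forall (F_ : nat -> Xi -> 'rV[R]_n) (G_ : nat -> Xi -> 'rV[R]_m) F G,
    (forall nu, FF (F_ nu)) -> (forall nu, GG (G_ nu)) -> FF F -> GG G ->
    {uniform, F_ @ \oo --> F} -> {uniform, G_ @ \oo --> G} ->
    h_ nu (F_ nu) (G_ nu) @[nu --> \oo] --> h F G)
  (* (e) *)
  (feasible_rule : exists F G, [/\ FF F, GG G, Deps eps delta (G xibar) &
    AP_feasible C psi (\val xibar) (F xibar, heaviside (G xibar))])
  (slater : forall F G, FF F -> GG G -> Deps eps delta (G xibar) ->
    AP_feasible C psi (\val xibar) (F xibar, heaviside (G xibar)) ->
    exists (x_ : nat -> 'rV[R]_n) (gamma_ : nat -> R),
      [/\ x_ nu @[nu --> \oo] --> F xibar,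
          (forall nu, 0 < gamma_ nu),
          gamma_ nu @[nu --> \oo] --> (0 : R),
          (forall nu (k : 'I_q.+1), (0 < k)%N ->
            psi k (\val xibar, x_ nu, heaviside (G xibar)) < 0) &
          (forall nu (z : 'rV[R]_n), norm2 (z - x_ nu) <= gamma_ nu ->
            C (z, heaviside (G xibar)))])
  (* (f) *)
  (Fhat : nat -> Xi -> 'rV[R]_n) (Ghat : nat -> Xi -> 'rV[R]_m)
  (hat_min : forall nu,
    near_minimizer
      (TP_feasible Rk C (psi_ nu) FF GG eps (delta_ nu) (xi_ nu))
      (TP_objective Rk (psi_ nu) (h_ nu) (xi_ nu))
      (tau_ nu) (Fhat nu, Ghat nu))
  (* convergent subsequence *)
  (N : set nat) (N_infinite : infinite_set N)
  (Fstar : Xi -> 'rV[R]_n) (Gstar : Xi -> 'rV[R]_m)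
  (Fstar_in : FF Fstar) (Gstar_in : GG Gstar)
  (Fhat_cvg : {uniform, Fhat @ within N \oo --> Fstar})
  (Ghat_cvg : {uniform, Ghat @ within N \oo --> Gstar}) :
  [/\ (\forall nu \near within N \oo, forall w,
         heaviside (Ghat nu (xi_ nu w)) = heaviside (Gstar xibar)),
      Deps eps delta (Gstar xibar),
      argmin (AP_feasible C psi (\val xibar))
        (fun z => psi ord0 (\val xibar, z.1, z.2))
        (Fstar xibar, heaviside (Gstar xibar)) &
      TP_objective Rk (psi_ nu) (h_ nu) (xi_ nu) (Fhat nu, Ghat nu)
        @[nu --> within N \oo] -->
      (minimum_value (AP_feasible C psi (\val xibar))
         (fun z => (psi ord0 (\val xibar, z.1, z.2))%:E)
       + (h Fstar Gstar)%:E)%E] /\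
  (FF (fun _ => 0) -> GG (fun _ => 0) ->
   vanishes_exactly_at_constants FF GG h ->
   [/\ constant_map Fstar, constant_map Gstar & h Fstar Gstar = 0]).
Proof.

(* Feasibility of the limit point and limit of the computed objectives *)
have PN := within_infinite_proper N_infinite.
have Ofin : finite_set [set: Omega] by case: P_finite.
have xi_cvgN w : xi_ nu w @[nu --> within N \oo] --> xibar.
  have : \val (xi_ nu w) @[nu --> within N \oo] --> \val xibar.
    exact: cvg_within_filter.
  exact: cvg_set_val.
have delta_cvgN : delta_ nu @[nu --> within N \oo] --> delta.
  exact: cvg_within_filter.
set ystar := heaviside (Gstar xibar).
have Gw w : Ghat nu (xi_ nu w) @[nu --> within N \oo] --> Gstar xibar.
  exact: (uniform_cvg_diag (GG_cont _ Gstar_in) Ghat_cvg (xi_cvgN w)).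
have Fw w : Fhat nu (xi_ nu w) @[nu --> within N \oo] --> Fstar xibar.
  exact: (uniform_cvg_diag (FF_cont _ Fstar_in) Fhat_cvg (xi_cvgN w)).
have feas nu : TP_feasible Rk C (psi_ nu) FF GG eps (delta_ nu) (xi_ nu)
    (Fhat nu, Ghat nu) by case: (hat_min nu).
(* Total mass 1 provides a scenario [w0], at which the limits in [Deps] and [C] are taken. *)
have [w0 _] : [set: Omega] !=set0.
  apply/set0P/eqP => O0; have := @probability_setT _ _ _ P.
  by rewrite O0 measure0 => /eqP; rewrite eqe eq_sym oner_eq0.
have Dstar : Deps eps delta (Gstar xibar).
  apply: (Deps_cvg eps_gt0 _ delta_cvgN (Gw w0)).
  by near=> nu; case: (feas nu) => _ _ _ _; apply.
(* The gap [eps] survives the limit and keeps [Gstar xibar] off the jumps of [heaviside]. *)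
have Gstar0 j : Gstar xibar ord0 j != 0.
  have [+ _] := (DepsP _ _ eps_gt0).1 Dstar j.
  by move=> /(lt_le_trans eps_gt0); rewrite normr_gt0.
have Hstar : \forall nu \near within N \oo, forall w,
    heaviside (Ghat nu (xi_ nu w)) = ystar.
  apply: filter_forall_finite => // w.
  exact: (Gw w _ (heaviside_near Gstar0)).
have Chat : \forall nu \near within N \oo, forall w,
    C (Fhat nu (xi_ nu w), ystar).
  near=> nu; move=> w.
  have <- : heaviside (Ghat nu (xi_ nu w)) = ystar by move: w; near: nu.
  by case: (feas nu) => _ _ _ + _; apply.
have Cstar : C (Fstar xibar, ystar).
  apply: (closed_cvg C C_closed (F := within N \oo)
    (u_ := fun nu => (Fhat nu (xi_ nu w0), ystar))).
    by apply: filterS Chat => nu /(_ w0).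
  by apply: cvg_nbhs_pair; [exact: Fw|exact: cvg_cst].
have risk_star k : Rk k (loss (psi_ nu k) (xi_ nu) (Fhat nu) (Ghat nu))
    @[nu --> within N \oo] --> (psi k (\val xibar, Fstar xibar, ystar))%:E.
  apply: (risk_loss_cvg (psi_ := psi_^~ k) (Rk_risk k) (Rk_cont k)
    _ xi_cvg Cstar Fw Hstar Chat).
  exact: psi_cvg.
have AP_star : AP_feasible C psi (\val xibar) (Fstar xibar, ystar).
  split=> // k k0; rewrite -lee_fin; apply: (cvge_le _ (risk_star k)).
  by near=> nu; case: (feas nu) => _ _ /(_ k k0).
have h_star : h_ nu (Fhat nu) (Ghat nu) @[nu --> within N \oo] --> h Fstar Gstar.
  apply: (@cvg_within_eq _ _ (fun nu => h_ nu (patch (fun=> Fstar) N Fhat nu)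
    (patch (fun=> Gstar) N Ghat nu))).
    by move=> nu nuN; rewrite !patchT.
  apply: h_cvg => //.
  - by move=> nu; rewrite /patch; case: ifP => // _; case: (feas nu).
  - by move=> nu; rewrite /patch; case: ifP => // _; case: (feas nu).
  - exact: (@cvg_patch_within {uniform Xi -> 'rV[R]_n}).
  - exact: (@cvg_patch_within {uniform Xi -> 'rV[R]_m}).
pose psi0 x y := psi ord0 (\val xibar, x, y).
have obj_star : TP_objective Rk (psi_ nu) (h_ nu) (xi_ nu) (Fhat nu, Ghat nu)
    @[nu --> within N \oo] --> (psi0 (Fstar xibar) ystar + h Fstar Gstar)%:E.
  rewrite EFinD; apply: cvgeD; [by []|exact: risk_star|].
  exact: cvg_EFin_fun h_star.

(* Upper bound by comparison rules, with [h] kept on both sides *)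
have upper F G : FF F -> GG G ->
    (forall j, eps < `|G xibar ord0 j| /\ (`|G xibar ord0 j|%:E < delta)%E) ->
    AP_feasible C psi (\val xibar) (F xibar, heaviside (G xibar)) ->
    psi0 (Fstar xibar) ystar + h Fstar Gstar <=
      psi0 (F xibar) (heaviside (G xibar)) + h F G.
  move=> FFF GGG Gint Fap.
  have GD : Deps eps delta (G xibar).
    by apply/(DepsP _ _ eps_gt0) => j; have [/ltW ? /ltW ?] := Gint j.
  have G0 j : G xibar ord0 j != 0.
    by rewrite -normr_gt0 (lt_trans eps_gt0)//; have [] := Gint j.
  have [x_ [gamma_ [x_cvg gamma_gt0 _ x_slater x_C]]] := slater _ _ FFF GGG GD Fap.
  set y := heaviside (G xibar) in x_slater x_C Fap *.
  (* Iterated limits: [mu] stays fixed while [nu] grows, since how soon the shifted rule becomes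
     feasible depends on [mu]. *)
  suff bound mu : psi0 (Fstar xibar) ystar + h Fstar Gstar <=
      psi0 (x_ mu) y + h F G.
    have x_psi0 : psi0 (x_ mu) y + h F G @[mu --> \oo] -->
        psi0 (F xibar) y + h F G.
      apply: cvgD; last exact: cvg_cst.
      apply: (@cvg_comp _ _ _ (fun mu => (\val xibar, x_ mu, y)) (psi ord0));
        last exact: psi_cont.
      by apply: cvg_nbhs_pair; [apply: cvg_nbhs_pair => //|]; exact: cvg_cst.
    by apply: (cvgr_to_ge x_psi0); near=> mu; exact: bound.
  pose Fmu s := F s + (x_ mu - F xibar).
  have FFmu : FF Fmu by exact: FF_shift.
  have hmu : h Fmu G = h F G.
    rewrite (h_shift _ _ (x_ mu - F xibar) 0 FFF GGG); congr (h _ _).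
    by apply/funext => s; rewrite addr0.
  have Fmubar : Fmu xibar = x_ mu by rewrite /Fmu addrC subrK.
  have Fmuw w : Fmu (xi_ nu w) @[nu --> within N \oo] --> x_ mu.
    rewrite -Fmubar; apply: (@cvg_comp _ _ _ (fun nu => xi_ nu w) Fmu _ _ _
      (xi_cvgN w)).
    exact: FF_cont.
  have Gmuw w : G (xi_ nu w) @[nu --> within N \oo] --> G xibar.
    apply: (@cvg_comp _ _ _ (fun nu => xi_ nu w) G _ _ _ (xi_cvgN w)).
    exact: GG_cont.
  have Hmu : \forall nu \near within N \oo, forall w,
      heaviside (G (xi_ nu w)) = y.
    apply: filter_forall_finite => // w.
    exact: (Gmuw w _ (heaviside_near G0)).
  have Cmu : \forall nu \near within N \oo, forall w, C (Fmu (xi_ nu w), y).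
    apply: filter_forall_finite => // w.
    (* The ball of radius [gamma_ mu] absorbs the variation of [Fmu] between [xibar] and the
       training points. *)
    near=> nu; apply: (x_C mu); near: nu.
    exact: (near_norm2_le (gamma_gt0 mu) (Fmuw w)).
  have Dmu : \forall nu \near within N \oo, forall w,
      Deps eps (delta_ nu) (G (xi_ nu w)).
    apply: filter_forall_finite => // w.
    exact: (Deps_near eps_gt0 Gint delta_cvgN (Gmuw w)).
  have Cxmu : C (x_ mu, y).
    by apply: (x_C mu); rewrite subrr norm2_0 ltW.
  have risk_mu k : Rk k (loss (psi_ nu k) (xi_ nu) Fmu G)
      @[nu --> within N \oo] --> (psi k (\val xibar, x_ mu, y))%:E.
    apply: (risk_loss_cvg (psi_ := psi_^~ k) (F_ := fun=> Fmu) (G_ := fun=> G)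
      (Rk_risk k) (Rk_cont k) _ xi_cvg Cxmu Fmuw Hmu Cmu).
    exact: psi_cvg.
  have Rmu : \forall nu \near within N \oo, forall k : 'I_q.+1, (0 < k)%N ->
      (Rk k (loss (psi_ nu k) (xi_ nu) Fmu G) <= 0)%E.
    apply: (@filter_forall _ _ _ (within N \oo)) => k.
    have [k0|k0] := boolP (0 < k)%N; last by near=> nu.
    (* The limit is negative at a Slater point, so the sign is inherited by the risks near the
       limit; a limit equal to 0 would not give this. *)
    have : \forall nu \near within N \oo,
        (Rk k (loss (psi_ nu k) (xi_ nu) Fmu G) < 0)%E.
      apply: (risk_mu k [set u | (u < 0)%E]).
      by apply: open_ereal_lt'; rewrite lte_fin; exact: x_slater.
    by apply: filterS => nu /ltW.
  have obj_mu : (TP_objective Rk (psi_ nu) (h_ nu) (xi_ nu) (Fmu, G) +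
      (tau_ nu)%:E)%E
      @[nu --> within N \oo] --> (psi0 (x_ mu) y + h Fmu G)%:E.
    (* The added 0 is the limit of [tau_]. *)
    rewrite -[X in X%:E]addr0 2!EFinD; apply: cvgeD; first by [].
      apply: cvgeD; [by []|exact: risk_mu|].
      apply: (@cvg_EFin_fun _ _ _ _ (fun nu => h_ nu Fmu G)).
      apply: cvg_within_filter; apply: (h_cvg (fun=> Fmu) (fun=> G)) => //.
        exact: (@cvg_cst {uniform Xi -> 'rV[R]_n}).
      exact: (@cvg_cst {uniform Xi -> 'rV[R]_m}).
    by apply: cvg_EFin_fun; exact: cvg_within_filter.
  rewrite -hmu -lee_fin; apply: (lee_cvg_to obj_star obj_mu).
  near=> nu; have [_ /le_trans + _] := hat_min nu; apply.
  rewrite leeD2r//; apply: ereal_inf_lbound; exists (Fmu, G) => //.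
  split => //=.
  - by near: nu.
  - by move=> w; have -> : heaviside (G (xi_ nu w)) = y; move: w; near: nu.
  - by near: nu.

(* Optimality of the limit point and vanishing of [h] *)
have star_min : argmin (AP_feasible C psi (\val xibar))
    (fun z => psi ord0 (\val xibar, z.1, z.2)) (Fstar xibar, ystar).
  split=> // -[x y] xy_ap /=.
  (* [C] has binary second components, so any feasible [y] is the sign pattern of some [g] that
     meets the strict bounds of [upper]. *)
  have [g gy gint] := heaviside_interior eps_gt0 delta_gt (C_binary _ xy_ap.1).
  have Fx : Fstar xibar + (x - Fstar xibar) = x by rewrite addrC subrK.
  have Gg : Gstar xibar + (g - Gstar xibar) = g by rewrite addrC subrK.
  have := upper _ _ (FF_shift _ (x - Fstar xibar) Fstar_in)
    (GG_shift _ (g - Gstar xibar) Gstar_in).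
  by rewrite -h_shift// Fx Gg gy lerD2r; apply.
split.
  split=> //; rewrite EFinD in obj_star.
  suff -> : minimum_value (AP_feasible C psi (\val xibar))
      (fun z => (psi ord0 (\val xibar, z.1, z.2))%:E) =
      (psi0 (Fstar xibar) ystar)%:E by exact: obj_star.
  apply/eqP; rewrite eq_le; apply/andP; split.
    by apply: ereal_inf_lbound; exists (Fstar xibar, ystar).
  by apply: le_ereal_inf_tmp => _ [z zap <-]; rewrite lee_fin; exact: star_min.2.
move=> FF0 GG0 hcst.
have [g gy gint] := heaviside_interior eps_gt0 delta_gt (C_binary _ Cstar).
have h_le0 : h Fstar Gstar <= 0.
  (* Shifted zero maps are constant rules. The value [g] stands in for [Gstar xibar], which may lie
     on the boundary of [Deps], and has the same sign pattern, so the [psi0] terms cancel. *)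
  have cF := FF_shift _ (Fstar xibar) FF0; have cG := GG_shift _ g GG0.
  have := upper _ _ cF cG; rewrite (hcst _ _ cF cG).2; last by split; eexists.
  by rewrite !add0r gy addr0 gerDl; apply.
have h0 : h Fstar Gstar = 0 by apply/eqP; rewrite eq_le h_le0 h_ge0.
by have [? ?] := (hcst _ _ Fstar_in Gstar_in).1 h0; split.
Unshelve. all: by end_near. Qed.
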